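(* Let $s=2$, $c_1\in\{-1,1\}$, $c_2,c_3\in\mathbb{R}$ with $c_2\neq0$, and consider the order $(2,1)$ stochastic Runge--Kutta coefficients $$\alpha^T=\begin{bmatrix}1-\tfrac1{2c_2}&\tfrac1{2c_2}\end{bmatrix},\quad \beta^{(1)T}=\begin{bmatrix}c_1&0\end{bmatrix},\quad \beta^{(2)}=\beta^{(3)}=\beta^{(4)}=0,$$ $$A^{(0)}=\begin{bmatrix}0&0\\c_2&0\end{bmatrix},\quad B^{(0)}=\begin{bmatrix}0&0\\c_3&0\end{bmatrix},\quad A^{(1)}=A^{(2)}=B^{(1)}=B^{(2)}=0 .$$ Then: (a) condition 9. holds iff $c_2=c_3^2$; condition 10. holds iff $c_2=c_1c_3$; (D1) holds iff $c_2=\frac23$; (D2) never holds. (b) The three conditions 9., 10. and (D1) cannot hold simultaneously. Conditions 9. and 10. hold together iff $c_2=1$, $c_3=c_1$; conditions 9. and (D1) hold together iff $c_2=\frac23$, $c_3=\pm\sqrt{\frac23}$; conditions 10. and (D1) hold together iff $c_2=\frac23$, $c_3=\frac23c_1$. (c) In each of these three combinations, all of the conditions 8.--50. are fulfilled with the exception of conditions 11. and 13.--16. and, if (D1) is combined with only one of the conditions 9., 10., the other one of these two. In particular, the scheme RDI1WM, given by $c_1=1$, $c_2=c_3=\frac23$, i.e. $\alpha^T=[\frac14\ \ \frac34]$, $\beta^{(1)T}=[1\ \ 0]$, $A^{(0)}_{21}=B^{(0)}_{21}=\frac23$ and all other coefficients zero, satisfies conditions 1.--8., condition 10. and (D1)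.
   Context: An explicit $s$-stage stochastic Runge--Kutta (SRK) method of the class considered is determined by vectors $\alpha,\beta^{(1)},\beta^{(2)},\beta^{(3)},\beta^{(4)}\in\mathbb{R}^s$ and matrices $A^{(q)},B^{(q)}\in\mathbb{R}^{s\times s}$, $q=0,1,2$, with $A^{(q)}_{ij}=B^{(q)}_{ij}=0$ for $j\ge i$. Let $e=(1,\dots,1)^T\in\mathbb{R}^s$. Products and powers of column vectors are component-wise. Order $(2,1)$ is understood through conditions 1.--8.; order $(2,2)$ through conditions 1.--50. The deterministic order three conditions are (D1) $\alpha^T(A^{(0)}e)^2=\frac13$ and (D2) $\alpha^T(A^{(0)}(A^{(0)}e))=\frac16$. The order conditions are: 1. $\alpha^Te=1$; 2. $\beta^{(4)T}e=0$; 3. $\beta^{(3)T}e=0$; 4. $(\beta^{(1)T}e)^2=1$; 5. $\beta^{(2)T}e=0$; 6. $\beta^{(1)T}B^{(1)}e=0$; 7. $\beta^{(3)T}B^{(2)}e=0$; 8. $\alpha^TA^{(0)}e=\tfrac12$; 9. $\alpha^T(B^{(0)}e)^2=\tfrac12$; 10. $(\beta^{(1)T}e)(\alpha^TB^{(0)}e)=\tfrac12$; 11. $(\beta^{(1)T}e)(\beta^{(1)T}A^{(1)}e)=\tfrac12$; 12. $\beta^{(3)T}A^{(2)}e=0$; 13. $\beta^{(2)T}B^{(1)}e=1$; 14. $\beta^{(4)T}B^{(2)}e=1$; 15. $(\beta^{(1)T}e)(\beta^{(1)T}(B^{(1)}e)^2)=\tfrac12$; 16. $(\beta^{(1)T}e)(\beta^{(3)T}(B^{(2)}e)^2)=\tfrac12$;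 17. $\beta^{(1)T}(B^{(1)}(B^{(1)}e))=0$; 18. $\beta^{(3)T}(B^{(2)}(B^{(1)}e))=0$; 19. $\beta^{(3)T}(A^{(2)}(B^{(0)}e))=0$; 20. $\beta^{(1)T}(A^{(1)}(B^{(0)}e))=0$; 21. $\alpha^T(B^{(0)}(B^{(1)}e))=0$; 22. $\beta^{(2)T}A^{(1)}e=0$; 23. $\beta^{(4)T}A^{(2)}e=0$; 24. $\beta^{(1)T}((A^{(1)}e)(B^{(1)}e))=0$; 25. $\beta^{(3)T}((A^{(2)}e)(B^{(2)}e))=0$; 26. $\beta^{(4)T}(A^{(2)}(B^{(0)}e))=0$; 27. $\beta^{(2)T}(A^{(1)}(B^{(0)}e))=0$; 28. $\beta^{(2)T}(A^{(1)}(B^{(0)}e)^2)=0$; 29. $\beta^{(4)T}(A^{(2)}(B^{(0)}e)^2)=0$; 30. $\beta^{(3)T}(B^{(2)}(A^{(1)}e))=0$; 31. $\beta^{(1)T}(B^{(1)}(A^{(1)}e))=0$; 32. $\beta^{(2)T}(B^{(1)}e)^2=0$; 33. $\beta^{(4)T}(B^{(2)}e)^2=0$; 34. $\beta^{(4)T}(B^{(2)}(B^{(1)}e))=0$; 35. $\beta^{(2)T}(B^{(1)}(B^{(1)}e))=0$; 36. $\beta^{(1)T}(B^{(1)}e)^3=0$; 37. $\beta^{(3)T}(B^{(2)}e)^3=0$; 38. $\beta^{(1)T}(B^{(1)}(B^{(1)}e)^2)=0$; 39. $\beta^{(3)T}(B^{(2)}(B^{(1)}e)^2)=0$; 40. $\alpha^T((B^{(0)}e)(B^{(0)}(B^{(1)}e)))=0$;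 41. $\beta^{(1)T}((A^{(1)}(B^{(0)}e))(B^{(1)}e))=0$; 42. $\beta^{(3)T}((A^{(2)}(B^{(0)}e))(B^{(2)}e))=0$; 43. $\beta^{(1)T}(A^{(1)}(B^{(0)}(B^{(1)}e)))=0$; 44. $\beta^{(3)T}(A^{(2)}(B^{(0)}(B^{(1)}e)))=0$; 45. $\beta^{(1)T}(B^{(1)}(A^{(1)}(B^{(0)}e)))=0$; 46. $\beta^{(3)T}(B^{(2)}(A^{(1)}(B^{(0)}e)))=0$; 47. $\beta^{(1)T}((B^{(1)}e)(B^{(1)}(B^{(1)}e)))=0$; 48. $\beta^{(3)T}((B^{(2)}e)(B^{(2)}(B^{(1)}e)))=0$; 49. $\beta^{(1)T}(B^{(1)}(B^{(1)}(B^{(1)}e)))=0$; 50. $\beta^{(3)T}(B^{(2)}(B^{(1)}(B^{(1)}e)))=0$. *)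

(* Defs.v *)
From HB Require Import structures.
From mathcomp Require Import all_boot all_order all_algebra.
From mathcomp Require Import reals.

Set Implicit Arguments.
Unset Strict Implicit.
Unset Printing Implicit Defensive.

Import Order.TTheory GRing.Theory Num.Theory.
Local Open Scope ring_scope.

Record srk (R : realType) (s : nat) := SRK {
  alpha : 'cV[R]_s;
  beta1 : 'cV[R]_s;
  beta2 : 'cV[R]_s;
  beta3 : 'cV[R]_s;
  beta4 : 'cV[R]_s;
  A0 : 'M[R]_s;
  A1 : 'M[R]_s;
  A2 : 'M[R]_s;
  B0 : 'M[R]_s;
  B1 : 'M[R]_s;
  B2 : 'M[R]_s
}.

Definition strictly_lower (R : realType) (s : nat) (X : 'M[R]_s) : Prop :=
  forall i j : 'I_s, (i <= j)%N -> X i j = 0.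

Definition srk_explicit (R : realType) (s : nat) (M : srk R s) : Prop :=
  [/\ strictly_lower (A0 M), strictly_lower (A1 M) & strictly_lower (A2 M)] /\
  [/\ strictly_lower (B0 M), strictly_lower (B1 M) & strictly_lower (B2 M)].

Definition dotc (R : realType) (s : nat) (u v : 'cV[R]_s) : R :=
  (u^T *m v) 0 0.

(* Component-wise product and powers of column vectors. *)
Definition cmul (R : realType) (s : nat) (u v : 'cV[R]_s) : 'cV[R]_s :=
  map2_mx *%R u v.

Definition cpow (R : realType) (s : nat) (v : 'cV[R]_s) (n : nat) : 'cV[R]_s :=
  map_mx (fun x => x ^+ n) v.

(* The k-th order condition, for k = 1, ..., 50; the value for other k is
   irrelevant. *)
Definition srk_cond (R : realType) (s : nat) (M : srk R s) (k : nat) : Prop :=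
  let: SRK a b1 b2 b3 b4 A0 A1 A2 B0 B1 B2 := M in
  let e : 'cV[R]_s := const_mx 1 in
  match k with
  | 1 => dotc a e = 1
  | 2 => dotc b4 e = 0
  | 3 => dotc b3 e = 0
  | 4 => dotc b1 e ^+ 2 = 1
  | 5 => dotc b2 e = 0
  | 6 => dotc b1 (B1 *m e) = 0
  | 7 => dotc b3 (B2 *m e) = 0
  | 8 => dotc a (A0 *m e) = 1 / 2
  | 9 => dotc a (cpow (B0 *m e) 2) = 1 / 2
  | 10 => dotc b1 e * dotc a (B0 *m e) = 1 / 2
  | 11 => dotc b1 e * dotc b1 (A1 *m e) = 1 / 2
  | 12 => dotc b3 (A2 *m e) = 0
  | 13 => dotc b2 (B1 *m e) = 1
  | 14 => dotc b4 (B2 *m e) = 1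
  | 15 => dotc b1 e * dotc b1 (cpow (B1 *m e) 2) = 1 / 2
  | 16 => dotc b1 e * dotc b3 (cpow (B2 *m e) 2) = 1 / 2
  | 17 => dotc b1 (B1 *m (B1 *m e)) = 0
  | 18 => dotc b3 (B2 *m (B1 *m e)) = 0
  | 19 => dotc b3 (A2 *m (B0 *m e)) = 0
  | 20 => dotc b1 (A1 *m (B0 *m e)) = 0
  | 21 => dotc a (B0 *m (B1 *m e)) = 0
  | 22 => dotc b2 (A1 *m e) = 0
  | 23 => dotc b4 (A2 *m e) = 0
  | 24 => dotc b1 (cmul (A1 *m e) (B1 *m e)) = 0
  | 25 => dotc b3 (cmul (A2 *m e) (B2 *m e)) = 0
  | 26 => dotc b4 (A2 *m (B0 *m e)) = 0
  | 27 => dotc b2 (A1 *m (B0 *m e)) = 0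
  | 28 => dotc b2 (A1 *m cpow (B0 *m e) 2) = 0
  | 29 => dotc b4 (A2 *m cpow (B0 *m e) 2) = 0
  | 30 => dotc b3 (B2 *m (A1 *m e)) = 0
  | 31 => dotc b1 (B1 *m (A1 *m e)) = 0
  | 32 => dotc b2 (cpow (B1 *m e) 2) = 0
  | 33 => dotc b4 (cpow (B2 *m e) 2) = 0
  | 34 => dotc b4 (B2 *m (B1 *m e)) = 0
  | 35 => dotc b2 (B1 *m (B1 *m e)) = 0
  | 36 => dotc b1 (cpow (B1 *m e) 3) = 0
  | 37 => dotc b3 (cpow (B2 *m e) 3) = 0
  | 38 => dotc b1 (B1 *m cpow (B1 *m e) 2) = 0
  | 39 => dotc b3 (B2 *m cpow (B1 *m e) 2) = 0
  | 40 => dotc a (cmul (B0 *m e) (B0 *m (B1 *m e))) = 0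
  | 41 => dotc b1 (cmul (A1 *m (B0 *m e)) (B1 *m e)) = 0
  | 42 => dotc b3 (cmul (A2 *m (B0 *m e)) (B2 *m e)) = 0
  | 43 => dotc b1 (A1 *m (B0 *m (B1 *m e))) = 0
  | 44 => dotc b3 (A2 *m (B0 *m (B1 *m e))) = 0
  | 45 => dotc b1 (B1 *m (A1 *m (B0 *m e))) = 0
  | 46 => dotc b3 (B2 *m (A1 *m (B0 *m e))) = 0
  | 47 => dotc b1 (cmul (B1 *m e) (B1 *m (B1 *m e))) = 0
  | 48 => dotc b3 (cmul (B2 *m e) (B2 *m (B1 *m e))) = 0
  | 49 => dotc b1 (B1 *m (B1 *m (B1 *m e))) = 0
  | 50 => dotc b3 (B2 *m (B1 *m (B1 *m e))) = 0
  | _ => False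
  end.

Definition srk_order21 (R : realType) (s : nat) (M : srk R s) : Prop :=
  forall k : nat, (1 <= k <= 8)%N -> srk_cond M k.

Definition srk_D1 (R : realType) (s : nat) (M : srk R s) : Prop :=
  let e : 'cV[R]_s := const_mx 1 in
  dotc (alpha M) (cpow (A0 M *m e) 2) = 1 / 3.

Definition srk_D2 (R : realType) (s : nat) (M : srk R s) : Prop :=
  let e : 'cV[R]_s := const_mx 1 in
  dotc (alpha M) (A0 M *m (A0 M *m e)) = 1 / 6.

(* [delta_mx 1 0] is the 2 x 2 matrix whose only nonzero entry is the 1 in its
   second row and first column. *)
Definition srk21_family (R : realType) (c1 c2 c3 : R) : srk R 2 := {|
  alpha := \col_(i < 2) [:: 1 - 1 / (2 * c2); 1 / (2 * c2)]`_i;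
  beta1 := \col_(i < 2) [:: c1; 0]`_i;
  beta2 := 0;
  beta3 := 0;
  beta4 := 0;
  A0 := c2 *: delta_mx 1 0;
  A1 := 0;
  A2 := 0;
  B0 := c3 *: delta_mx 1 0;
  B1 := 0;
  B2 := 0
|}.

Definition RDI1WM (R : realType) : srk R 2 := {|
  alpha := \col_(i < 2) [:: 1 / 4; 3 / 4]`_i;
  beta1 := \col_(i < 2) [:: 1; 0]`_i;
  beta2 := 0;
  beta3 := 0;
  beta4 := 0;
  A0 := (2 / 3) *: delta_mx 1 0;
  A1 := 0;
  A2 := 0;
  B0 := (2 / 3) *: delta_mx 1 0;
  B1 := 0;
  B2 := 0
|}.

(* Main.v *)
Require Import Defs.
From HB Require Import structures.
From mathcomp Require Import all_boot all_order all_algebra.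
From mathcomp Require Import reals ring lra.

Import Order.TTheory GRing.Theory Num.Theory.
Local Open Scope ring_scope.

Set Implicit Arguments.
Unset Strict Implicit.
Unset Printing Implicit Defensive.

(** Only [alpha], [beta1], [A0] and [B0] are nonzero. Among conditions 1 to 50, only 1, 4, 8, 9 and
    10 are built from these alone; every other left-hand side contains a zero factor, so the
    condition holds exactly when its right-hand side is 0, and 11 and 13 to 16 fail ([family_condE],
    [family_condN]). Since [A0] e = (0, c2) and [B0] e = (0, c3), only the weight 1/(2 c2) survives:
    9 reads c3^2/(2 c2) = 1/2, 10 reads c1 c3/(2 c2) = 1/2, and (D1) reads c2/2 = 1/3. As [A0]
    squares to zero, (D2) would say 0 = 1/6. Part (b) is then algebra using c1^2 = 1: conditions 9
    and 10 force c2 = 1, which contradicts c2 = 2/3. *)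

Lemma dotc2 (R : realType) (u v : 'cV[R]_2) :
  dotc u v = u 0 0 * v 0 0 + u 1 0 * v 1 0.
Proof.
rewrite /dotc mxE 2!big_ord_recl big_ord0 addr0 !mxE.
by congr (_ + u _ _ * v _ _); apply/val_inj.
Qed.

Lemma dotc0l (R : realType) (s : nat) (v : 'cV[R]_s) : dotc 0 v = 0.
Proof. by rewrite /dotc trmx0 mul0mx mxE. Qed.

Lemma dotc0r (R : realType) (s : nat) (u : 'cV[R]_s) : dotc u 0 = 0.
Proof. by rewrite /dotc mulmx0 mxE. Qed.

Lemma cpow0S (R : realType) (s n : nat) : cpow (0 : 'cV[R]_s) n.+1 = 0.
Proof. by apply/matrixP => i j; rewrite !mxE expr0n. Qed.

Lemma cmul0l (R : realType) (s : nat) (v : 'cV[R]_s) : cmul 0 v = 0.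
Proof. by apply/matrixP => i j; rewrite !mxE mul0r. Qed.

Lemma cmul0r (R : realType) (s : nat) (u : 'cV[R]_s) : cmul u 0 = 0.
Proof. by apply/matrixP => i j; rewrite !mxE mulr0. Qed.

(** The zero first component is what matters: it removes the first weight of [alpha] from each
    condition, and a second application of such a matrix gives 0. *)
Lemma scale_delta10_mul (R : realType) (c : R) (v : 'cV[R]_2) :
  (c *: delta_mx 1 0) *m v = \col_(i < 2) [:: 0; c * v 0 0]`_i.
Proof.
apply/matrixP => i j; rewrite (ord1 j) !mxE 2!big_ord_recl big_ord0 !mxE /=.
have -> : lift ord0 ord0 = 1 :> 'I_2 by apply/val_inj.
by case: i => [[|[|//]]] ?; rewrite /= ?mulr0 ?mul0r ?mulr1 !addr0.
Qed.

Lemma strictly_lower_scale_delta10 (R : realType) (c : R) :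
  strictly_lower (c *: (delta_mx 1 0 : 'M[R]_2)).
Proof.
move=> i j; rewrite !mxE.
by case: i => [[|[|//]]] ?; case: j => [[|[|//]]] ?; rewrite /= ?mulr0.
Qed.

Lemma strictly_lower0 (R : realType) (s : nat) :
  strictly_lower (0 : 'M[R]_s).
Proof. by move=> i j _; rewrite mxE. Qed.

Definition srk0E :=
  (mul0mx, mulmx0, dotc0l, dotc0r, cpow0S, cmul0l, cmul0r, mulr0).

Section Family.

Variables (R : realType) (c1 c2 c3 : R).
Hypotheses (c1_sq : c1 ^+ 2 = 1) (c2_neq0 : c2 != 0).

Let M := srk21_family c1 c2 c3.

Lemma family_explicit : srk_explicit M.
Proof.
by split; split; first [exact: strictly_lower_scale_delta10
                       | exact: strictly_lower0].
Qed.

Lemma family_condE (k : nat) :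
  (1 <= k <= 50)%N -> k \notin [:: 9; 10; 11; 13; 14; 15; 16]%N ->
  srk_cond M k.
Proof.
do 51 (try case: k => [|k] //=); move=> _ _.
(* Vanishing factors settle all cases but 1, 4 and 8. Condition 4 is then [c1_sq]; 1 and 8 are left
   to [field]. *)
all: rewrite ?srk0E // ?dotc2 ?scale_delta10_mul ?mxE /=.
all: rewrite ?mulr1 ?mulr0 ?mul0r ?addr0 //.
- by field.
- by field.
Qed.

Lemma family_order21 : srk_order21 M.
Proof.
move=> k /andP[k1 k8]; apply: family_condE; first by rewrite k1 (leq_trans k8).
by rewrite !inE; do 9 (try case: k k1 k8 => [|k] k1 k8 //).
Qed.

Lemma family_condN (k : nat) :
  k \in [:: 11; 13; 14; 15; 16]%N -> ~ srk_cond M k.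
Proof.
(* The left-hand side collapses to 0, while the right-hand side is 1 or 1/2. *)
rewrite !inE => /or4P[|||/orP[]] /eqP-> /=; rewrite !srk0E; lra.
Qed.

Lemma family_cond9 : srk_cond M 9 <-> c2 = c3 ^+ 2.
Proof.
rewrite /= dotc2 scale_delta10_mul !mxE /= expr0n mulr0 add0r mulr1.
have -> : 1 / (2 * c2) * c3 ^+ 2 = c3 ^+ 2 / c2 / 2 by field.
split=> [h|<-]; last by rewrite divff.
have /(congr1 ( *%R^~ c2)) : c3 ^+ 2 / c2 = 1 by lra.
by rewrite divfK // mul1r.
Qed.

Lemma family_cond10 : srk_cond M 10 <-> c2 = c1 * c3.
Proof.
rewrite /= !dotc2 scale_delta10_mul !mxE /= mulr0 add0r !mulr1 addr0.
have -> : c1 * (1 / (2 * c2) * c3) = c1 * c3 / c2 / 2 by field.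
split=> [h|<-]; last by rewrite divff.
have /(congr1 ( *%R^~ c2)) : c1 * c3 / c2 = 1 by lra.
by rewrite divfK // mul1r.
Qed.

Lemma family_D1 : srk_D1 M <-> c2 = 2 / 3.
Proof.
rewrite /srk_D1 /= dotc2 scale_delta10_mul !mxE /= expr0n mulr0 add0r mulr1.
have -> : 1 / (2 * c2) * c2 ^+ 2 = c2 / 2 by field.
by split=> h; lra.
Qed.

Lemma family_D2N : ~ srk_D2 M.
Proof.
rewrite /srk_D2 /= dotc2 !scale_delta10_mul !mxE /= !mulr0 addr0; lra.
Qed.

Lemma family_cond9_10 :
  srk_cond M 9 /\ srk_cond M 10 <-> c2 = 1 /\ c3 = c1.
Proof.
rewrite family_cond9 family_cond10; split=> [[h9 h10]|[-> ->]]; last first.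
  by rewrite -expr2 c1_sq.
have c2E : c2 = 1.
  (* c2^2 = (c1 c3)^2 = c3^2 = c2, and c2 can be cancelled. *)
  by apply: (mulfI c2_neq0); rewrite mulr1 {1 2}h10 h9 -[RHS]mul1r -c1_sq; ring.
(* c3 = c1^2 c3 = c1 (c1 c3) = c1 c2 = c1. *)
by split=> //; rewrite -[c3]mul1r -c1_sq expr2 -mulrA -h10 c2E mulr1.
Qed.

Lemma family_cond9_D1 : srk_cond M 9 /\ srk_D1 M <->
  c2 = 2 / 3 /\ (c3 = Num.sqrt (2 / 3) \/ c3 = - Num.sqrt (2 / 3)).
Proof.
have sq23 : Num.sqrt (2 / 3) ^+ 2 = 2 / 3 :> R by rewrite sqr_sqrtr //; lra.
rewrite family_cond9 family_D1; split=> [[h9 hD]|[-> [->|->]]].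
- by split=> //; apply/pred2P; rewrite -eqf_sqr sq23 -hD h9.
- by rewrite sq23.
- by rewrite sqrrN sq23.
Qed.

Lemma family_cond10_D1 :
  srk_cond M 10 /\ srk_D1 M <-> c2 = 2 / 3 /\ c3 = 2 / 3 * c1.
Proof.
rewrite family_cond10 family_D1; split=> [[h h1]|[-> ->]].
  by split=> //; rewrite -h1 h mulrAC -expr2 c1_sq mul1r.
by rewrite mulrCA -expr2 c1_sq mulr1.
Qed.

Lemma family_cond9_10_D1N : ~ (srk_cond M 9 /\ srk_cond M 10 /\ srk_D1 M).
Proof.
move=> [h9 [h10 /family_D1 hD]].
have [+ _] := iffLR family_cond9_10 (conj h9 h10); rewrite hD; lra.
Qed.

(* Conditions 9 and 10 are the only ones whose validity depends on the
   parameters, so they are the only ones [L] has to decide. *)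
Lemma family_cond_notin (L : seq nat) :
  all [in L] [:: 11; 13; 14; 15; 16]%N ->
  all [in [:: 9; 10; 11; 13; 14; 15; 16]%N] L ->
  (srk_cond M 9 <-> 9%N \notin L) -> (srk_cond M 10 <-> 10%N \notin L) ->
  forall k : nat, (8 <= k <= 50)%N -> (srk_cond M k <-> k \notin L).
Proof.
move=> /allP subL /allP Lsub L9 L10 k /andP[k8 k50].
have [->//|k9] := eqVneq k 9%N; have [->//|k10] := eqVneq k 10%N.
have [kN|kN] := boolP (k \in [:: 11; 13; 14; 15; 16]%N).
  have kL : k \in L := subL _ kN.
  by rewrite kL; split=> // /(family_condN kN).
have kF : k \notin [:: 9; 10; 11; 13; 14; 15; 16]%N.
  by rewrite in_cons (negPf k9) in_cons (negPf k10).
split=> _; first by apply: contra kF => /Lsub.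
by apply: family_condE; rewrite // (leq_trans _ k8).
Qed.

End Family.

(** At c2 = 2/3 the second weight 1/(2 c2) is 3/4. With c1 = 1 this is the member of the family
    singled out by condition 10 and (D1), so its properties are inherited. *)
Lemma RDI1WM_family (R : realType) : RDI1WM R = srk21_family 1 (2 / 3) (2 / 3).
Proof.
rewrite /RDI1WM /srk21_family.
have -> : 1 - 1 / (2 * (2 / 3)) = 1 / 4 :> R by field.
by have -> : 1 / (2 * (2 / 3)) = 3 / 4 :> R by field.
Qed.

Theorem mainTheorem5 (R : realType) :
  (forall c1 c2 c3 : R, (c1 = -1 \/ c1 = 1) -> c2 <> 0 ->
    let M := srk21_family c1 c2 c3 in
    (srk_explicit M /\ srk_order21 M) /\
    (* (a) *)
    ((srk_cond M 9 <-> c2 = c3 ^+ 2) /\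
     (srk_cond M 10 <-> c2 = c1 * c3) /\
     (srk_D1 M <-> c2 = 2 / 3) /\
     ~ srk_D2 M) /\
    (* (b) *)
    (~ (srk_cond M 9 /\ srk_cond M 10 /\ srk_D1 M) /\
     (srk_cond M 9 /\ srk_cond M 10 <-> c2 = 1 /\ c3 = c1) /\
     (srk_cond M 9 /\ srk_D1 M <->
        c2 = 2 / 3 /\ (c3 = Num.sqrt (2 / 3) \/ c3 = - Num.sqrt (2 / 3))) /\
     (srk_cond M 10 /\ srk_D1 M <-> c2 = 2 / 3 /\ c3 = 2 / 3 * c1)) /\
    (* (c) *)
    ((srk_cond M 9 /\ srk_cond M 10 ->
        forall k : nat, (8 <= k <= 50)%N ->
          (srk_cond M k <-> k \notin [:: 11; 13; 14; 15; 16]%N)) /\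
     (srk_cond M 9 /\ srk_D1 M ->
        forall k : nat, (8 <= k <= 50)%N ->
          (srk_cond M k <-> k \notin [:: 10; 11; 13; 14; 15; 16]%N)) /\
     (srk_cond M 10 /\ srk_D1 M ->
        forall k : nat, (8 <= k <= 50)%N ->
          (srk_cond M k <-> k \notin [:: 9; 11; 13; 14; 15; 16]%N)))) /\
  (RDI1WM R = srk21_family 1 (2 / 3) (2 / 3) /\
   srk_order21 (RDI1WM R) /\
   srk_cond (RDI1WM R) 10 /\
   srk_D1 (RDI1WM R)).
Proof.
split=> [c1 c2 c3 c1E /eqP c2_neq0 M|].
  have c1_sq : c1 ^+ 2 = 1 by case: c1E => ->; rewrite ?sqrrN expr1n.
  have N3 : ~ (srk_cond M 9 /\ srk_cond M 10 /\ srk_D1 M).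
    exact: family_cond9_10_D1N.
  split; [|split; [|split]].
  - by split; [exact: family_explicit | exact: family_order21].
  - split; first exact: family_cond9.
    split; first exact: family_cond10.
    by split; [exact: family_D1 | exact: family_D2N].
  - split; first exact: N3.
    split; first exact: family_cond9_10.
    by split; [exact: family_cond9_D1 | exact: family_cond10_D1].
  (* When (D1) is paired with one of 9 and 10, the other one must fail, since [N3] excludes all
     three together. *)
  - split; [|split] => -[h1 h2]; apply: family_cond_notin => //;
      by split=> // h; case: N3.
have c2_neq0 : 2 / 3 != 0 :> R by rewrite mulf_neq0 ?invr_eq0 ?pnatr_eq0.
have one_sq : (1 : R) ^+ 2 = 1 by rewrite expr1n.
have [h10 hD1] : srk_cond (RDI1WM R) 10 /\ srk_D1 (RDI1WM R).
  by rewrite RDI1WM_family; apply/family_cond10_D1; rewrite ?mulr1.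
split; first exact: RDI1WM_family.
by split=> //; rewrite RDI1WM_family; exact: family_order21.
Qed.
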